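(* Let $G$ be a finite, simple, undirected, connected graph of order $n \geq 6$. Then $\dim(G) = n-4$ and $G$ contains exactly two basis forced vertices if and only if $G \in \mathcal{F}$, where $\mathcal{F}$ is the graph family defined in the context. Moreover, if $G\in\mathcal{F}$, the two basis forced vertices of $G$ are the vertices $u$ and $v$ named in the definition of the family $\mathcal{F}$.
   Context: For vertices $x,y$ of a connected graph $G$, $d_G(x,y)$ is the number of edges in a shortest $x$–$y$ path. A vertex $x$ resolves two vertices $y,z$ if $d_G(y,x)\neq d_G(z,x)$. A set $R\subseteq V(G)$ is a resolving set of $G$ if every pair of distinct vertices of $G$ is resolved by some vertex of $R$. A metric basis of $G$ is a resolving set of smallest possible cardinality, and this cardinality is the metric dimension $\dim(G)$. A basis forced vertex of $G$ is a vertex that belongs to every metric basis of $G$. The graph $G_3$ has vertex set $\{a,b,c,d,u,v\}$ and edge set $\{ab, bc, cd, da, ac, va, vd, ud, uc, uv\}$ (ten edges). The family $\mathcal{F}$ consists of the following graphs (up to isomorphism). A graph $G$ of order $n$ belongs to $\mathcal{F}$ if either $G$ is the graph $G_3$ (with $u$ and $v$ as named above), or $V(G)=K\cup\{u,v\}$ where $u\ne v$ are not in $K$, $K$ is a clique with $n-2$ vertices, and $K$ can be partitioned into four nonempty sets $V_1,V_2,V_3,V_4$ such that $u$ is adjacent to all vertices of $V_1\cup V_2$ but to no vertex of $V_3\cup V_4$, and $v$ is adjacent to all vertices of $V_1\cup V_3$ but to no vertex of $V_2\cup V_4$; the vertices $u$ and $v$ may or may not be adjacent to each other. *)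

(* Defs.v *)
From mathcomp Require Import all_boot.
Set Implicit Arguments.
Unset Strict Implicit.
Unset Printing Implicit Defensive.

(* A graph is given by its adjacency relation e on a finite vertex type T;
   simplicity (symmetry, irreflexivity) and connectedness are hypotheses of
   the theorems. *)

Section MetricDimension.
Variables (T : finType) (e : rel T).

Definition has_walk (x y : T) (k : nat) : bool :=
  [exists p : k.-tuple T, path e x p && (last x p == y)].

(* Shortest walks are paths, hence have fewer than #|T| edges; the junk value
   #|T| is taken when x and y are not connected. *)
Definition dist (x y : T) : nat := find (has_walk x y) (iota 0 #|T|).

Definition resolves (x y z : T) : bool := dist y x != dist z x.

Definition resolving (R : {set T}) : bool :=
  [forall y, forall z, (y != z) ==> [exists x in R, resolves x y z]].

(* The full vertex set is resolving, so this is a genuine minimum. *)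
Definition metric_dim : nat := #|[arg min_(R < [set: T] | resolving R) #|R|]|.

Definition metric_basis (R : {set T}) : bool :=
  resolving R && (#|R| == metric_dim).

Definition basis_forced : {set T} :=
  [set x | [forall R : {set T}, metric_basis R ==> (x \in R)]].

Definition clique (K : {set T}) : Prop :=
  {in K &, forall x y, x != y -> e x y}.

(* Up to isomorphism: T is enumerated by the six names. *)
Definition is_G3 (u v : T) : Prop :=
  exists a b c d : T,
    let E := [:: (a, b); (b, c); (c, d); (d, a); (a, c);
                 (v, a); (v, d); (u, d); (u, c); (u, v)] in
    [/\ uniq [:: a; b; c; d; u; v],
        forall x, x \in [:: a; b; c; d; u; v]
      & forall x y, e x y = ((x, y) \in E) || ((y, x) \in E)].

(* uniq makes the four sets distinct, so that the set of sets given to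
   partition really has four blocks; partition makes them nonempty.  Nothing is
   required of e u v. *)
Definition is_clique_type (u v : T) : Prop :=
  exists K V1 V2 V3 V4 : {set T},
    [/\ [/\ u != v, u \notin K, v \notin K & K :|: [set u; v] = [set: T]],
        clique K /\ #|K| = #|T| - 2,
        uniq [:: V1; V2; V3; V4] /\ partition [set V1; V2; V3; V4] K,
        {in V1 :|: V2, forall x, e u x} /\ {in V3 :|: V4, forall x, ~~ e u x}
      & {in V1 :|: V3, forall x, e v x} /\ {in V2 :|: V4, forall x, ~~ e v x}].

(* Membership of the graph in the family, with the vertices named u and v. *)
Definition family_with (u v : T) : Prop := is_G3 u v \/ is_clique_type u v.

Definition in_family : Prop := exists u v : T, family_with u v.

End MetricDimension.

(* Main.v *)
(* Work with complements: a set S is "separable" when the vertices outside S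
   resolve every pair in S, so dim = n - 4 says that 4 is the largest size of a
   separable set, and f is basis forced iff no separable 4-set contains f.
   If f is forced and S is a separable 4-set, exchanging vertices of S with f
   shows that the vertices outside S + f split S into at most two classes.
   Applied to both forced vertices u and v this leaves no choice: u splits S as
   ab|cd, v splits S as ac|bd (up to naming), and every other vertex outside S
   is equidistant from all of S.  Hence each further vertex is a twin of a
   member of S, so the six vertices a, b, c, d, u, v carry a graph metric of
   diameter at most 3, and a finite check over such metrics leaves only the
   clique pattern and G3.  In G3 no further twin is possible. *)

Require Import Defs.
From mathcomp Require Import all_boot.
From mathcomp Require Import zify ring.

Set Implicit Arguments.
Unset Strict Implicit.
Unset Printing Implicit Defensive.

(** * Exhaustive search over distance tables on six points *)

(** The predicate is passed down as a continuation, so the $3^n$ words over 1, 2, 3 are tested one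
    by one and never listed. *)
Fixpoint all_words (n : nat) (P : seq nat -> bool) : bool :=
  if n is n'.+1 then all (fun i => all_words n' (fun s => P (i :: s))) [:: 1; 2; 3] else P [::].

Lemma all_wordsP (P : seq nat -> bool) (s : seq nat) :
  all_words (size s) P -> all [pred i | 0 < i <= 3] s -> P s.
Proof.
elim: s P => [|i s IHs] P //= /and4P[P1 P2 P3 _] /andP[i3 s3].
by case: i i3 => [|[|[|[|]]]] //= _; move: s3; apply: IHs (fun s => P (_ :: s)) _.
Qed.

(* The points 0, ..., 5 stand for a, b, c, d, u, v, and q lists the distances
   ua = ub, uc = ud, va = vc, vb = vd, uv, ab, ac, ad, bc, bd, cd. *)
Definition hex_dist (q : seq nat) : nat -> nat -> nat :=
  let q := nth 0 q in
  let m := [:: [::  0;  q 5; q 6; q 7; q 0; q 2];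
               [:: q 5;  0;  q 8; q 9; q 0; q 3];
               [:: q 6; q 8;  0; q 10; q 1; q 2];
               [:: q 7; q 9; q 10; 0;  q 1; q 3];
               [:: q 0; q 0; q 1; q 1;  0;  q 4];
               [:: q 2; q 3; q 2; q 3; q 4;  0]] in
  fun i j => nth 0 (nth [::] m i) j.

(* The points a, b, c, d here are the vertices d, c, a, b of is_G3. *)
Definition G3_distances : seq nat := [:: 1; 2; 1; 2; 1; 1; 1; 2; 1; 1; 1].

(** A necessary condition for carrying a graph metric: a geodesic from [i] to [j] begins at a
    neighbour of [i] one unit closer to [j]. *)
Definition hex_steps (D : nat -> nat -> nat) : bool :=
  all (fun i => all (fun j => (1 < D i j) ==>
    has (fun k => (D i k == 1) && (D k j == (D i j).-1)) (iota 0 6)) (iota 0 6)) (iota 0 6).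

Definition hex_clash (D : nat -> nat -> nat) (s : seq nat) : bool :=
  has (fun i => has (fun j => (i != j) &&
    all (fun k => (k \notin s) ==> (D k i == D k j)) (iota 0 6)) s) s.

(** Six-point version of lying in no separable four-set; ordered triples filtered by [uniq] stand in
    for the four-sets through [f]. *)
Definition hex_forced (D : nat -> nat -> nat) (f : nat) : bool :=
  all (fun i => all (fun j => all (fun k =>
    uniq [:: f; i; j; k] ==> hex_clash D [:: f; i; j; k]) (iota 0 6)) (iota 0 6)) (iota 0 6).

Definition hex_good (q : seq nat) : bool :=
  let D := hex_dist q in
  [&& nth 0 q 0 < nth 0 q 1, nth 0 q 2 < nth 0 q 3, hex_steps D, hex_forced D 4 & hex_forced D 5].

(** Settled by evaluating all $3^{11}$ tables. The first alternative is the clique pattern, with the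
    distance [uv] left open; the second completes the table to [G3_distances]. *)
Lemma hex_classification (q : seq nat) : size q = 11 ->
  all [pred i | 0 < i <= 3] q -> hex_good q ->
  take 4 q = [:: 1; 2; 1; 2] /\
  (drop 5 q = [:: 1; 1; 1; 1; 1; 1] \/ drop 4 q = [:: 1; 1; 1; 2; 1; 1; 1]).
Proof.
pose P q := hex_good q ==> (take 4 q == [:: 1; 2; 1; 2]) &&
  ((drop 5 q == [:: 1; 1; 1; 1; 1; 1]) || (drop 4 q == [:: 1; 1; 1; 2; 1; 1; 1])).
move=> sq /(@all_wordsP P); rewrite sq; have -> : all_words 11 P by lazy.
by move=> /(_ isT)/implyP Pq /Pq/andP[/eqP-> /orP[]/eqP->]; split; auto.
Qed.

Ltac reorder ps := apply: perm_trans ps _; apply/permP => ? /=; ring.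

Lemma uniq_map_inj (T1 T2 : eqType) (f : T1 -> T2) (s : seq T1) :
  uniq (map f s) -> {in s &, injective f}.
Proof.
move=> us y z ys; have /(nthP y)[i li <-] := ys => /(nthP y)[j lj <-] /eqP.
by rewrite -!(nth_map y (f y)) // nth_uniq ?size_map // => /eqP->.
Qed.

(** * Basic properties of the distance *)

Section Distance.
Variables (T : finType) (e : rel T).
Hypotheses (e_sym : symmetric e) (e_irr : irreflexive e).
Hypothesis e_conn : forall x y : T, connect e x y.

Local Notation dist := (dist e).

Lemma has_walkP (x y : T) (k : nat) :
  reflect (exists p, [/\ size p = k, path e x p & last x p = y])
          (has_walk e x y k).
Proof.
apply: (iffP existsP) => [[p /andP[ep /eqP ly]]|[p [sp ep ly]]].
  by exists p; rewrite size_tuple.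
by have sp' : size p == k by [apply/eqP]; exists (Tuple sp'); rewrite ep ly /=.
Qed.

Lemma dist_spec (x y : T) :
  has_walk e x y (dist x y) /\ forall k, has_walk e x y k -> dist x y <= k.
Proof.
have hasW : has (has_walk e x y) (iota 0 #|T|).
  have /connectP[p0 ep0 ->] := e_conn x y.
  (* A walk without repeated vertices has length below [#|T|], so [find] succeeds and the default
     value of [dist] does not occur. *)
  case: (shortenP ep0) => p ep up _.
  apply/hasP; exists (size p); last by apply/has_walkP; exists p.
  by rewrite mem_iota add0n /=; have := max_card [in x :: p]; rewrite (card_uniqP up).
have lt : dist x y < #|T| by move: hasW; rewrite has_find size_iota.
split; first by have := nth_find 0 hasW; rewrite nth_iota.
move=> k Wk; rewrite leqNgt; apply/negP => ltk.
by have := before_find 0 ltk; rewrite nth_iota ?Wk // (ltn_trans ltk lt).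
Qed.

Lemma dist_le (x y : T) (p : seq T) : path e x p -> last x p = y -> dist x y <= size p.
Proof. by move=> ep ly; apply: (dist_spec x y).2; apply/has_walkP; exists p. Qed.

Lemma distxx (x : T) : dist x x = 0.
Proof. by apply/eqP; rewrite -leqn0 (@dist_le x x [::]). Qed.

Lemma dist_eq0 (x y : T) : (dist x y == 0) = (x == y).
Proof.
apply/eqP/eqP => [d0|->]; last exact: distxx.
by have [/has_walkP[p [sp _ <-]] _] := dist_spec x y; rewrite d0 in sp; case: p sp.
Qed.

Lemma dist_leC (x y : T) : dist x y <= dist y x.
Proof.
have [/has_walkP[p [sp ep ly]] _] := dist_spec y x.
rewrite -sp -(size_belast y p) -size_rev; apply: dist_le.
  by rewrite -ly rev_path; under eq_path do rewrite e_sym.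
by case: p ly {sp ep} => [|z p] /= => [->|_] //; rewrite rev_cons last_rcons.
Qed.

Lemma distC (x y : T) : dist x y = dist y x.
Proof. by apply/eqP; rewrite eqn_leq !dist_leC. Qed.

Lemma dist_eq1 (x y : T) : (dist x y == 1) = e x y.
Proof.
apply/eqP/idP => [d1|exy].
  have [/has_walkP[p [sp ep ly]] _] := dist_spec x y.
  by case: p sp ep ly => [|z [|t p]]; rewrite d1 //= => _; rewrite andbT => ? <-.
apply/eqP; rewrite eqn_leq (@dist_le x y [:: y]) //= ?exy // lt0n dist_eq0.
by apply/eqP => xy; rewrite xy e_irr in exy.
Qed.

Lemma dist_step (x y : T) : x != y -> exists2 z, e x z & dist z y = (dist x y).-1.
Proof.
have [/has_walkP[p [sp ep ly]] _] := dist_spec x y.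
case: p sp ep ly => [|z p] /= sp; first by move=> _ ->; rewrite eqxx.
case/andP=> xz ep ly _; exists z => //; apply/eqP; rewrite -sp eqn_leq (dist_le ep ly) /=.
have [/has_walkP[q [<- eq lq]] _] := dist_spec z y.
by have := @dist_le x y (z :: q); rewrite -sp /= xz => /(_ eq lq).
Qed.


(** Stepping from [y] along a geodesic towards [x] lowers the distance by one each time. *)
Lemma dist_layer (x y : T) (k : nat) : k <= dist x y -> exists z, dist x z = k.
Proof.
have [n] := ubnP (dist x y); elim: n y => // n IHn y; rewrite ltnS => len lek.
have [->|neq] := eqVneq k (dist x y); first by exists y.
have [yx|/dist_step[z _ dz]] := eqVneq y x; first by move: lek neq; rewrite yx distxx leqn0 => ->.
by apply: (IHn z); rewrite distC dz distC; lia.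
Qed.


(** * Separable sets, the complements of resolving sets *)

(** Lists are used so that members can be named and permuted; distinctness is demanded separately
    through [uniq]. *)
Definition separable (s : seq T) : Prop :=
  {in s &, forall y z, y != z -> exists2 x, x \notin s & dist x y != dist x z}.

Lemma eq_separable (s s' : seq T) : s =i s' -> separable s -> separable s'.
Proof.
move=> ss' sep y z; rewrite -!ss' => ys zs /(sep y z ys zs)[x xs dx].
by exists x; rewrite // -ss'.
Qed.

(** Only pairs outside [R] matter: a vertex is the only one at distance 0 from itself, so it
    resolves every pair that contains it. *)
Lemma resolvingP (R : {set T}) :
  reflect (separable (enum (~: R))) (resolving e R).
Proof.
have mem x : (x \in enum (~: R)) = (x \notin R) by rewrite mem_enum inE.
apply: (iffP forallP) => [res y z _ _ yz|sep y].
  have /forallP/(_ z)/implyP/(_ yz)/existsP[x /andP[xR dx]] := res y.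
  by exists x; [rewrite mem xR|rewrite ![dist x _]distC].
apply/forallP=> z; apply/implyP=> yz; apply/existsP.
have [yR|yR] := boolP (y \in R).
  by exists y; rewrite yR /resolves distxx eq_sym dist_eq0 eq_sym.
have [zR|zR] := boolP (z \in R).
  by exists z; rewrite zR /resolves distxx dist_eq0.
have [||x xR dx] := sep y z _ _ yz; rewrite ?mem //.
by exists x; rewrite /resolves ![dist _ x]distC dx andbT; rewrite mem negbK in xR.
Qed.

Lemma metric_dim_min (R : {set T}) : resolving e R -> metric_dim e <= #|R|.
Proof.
rewrite /metric_dim; case: arg_minnP => [|i _ mini resR]; last exact: mini.
by apply/resolvingP=> y z; rewrite mem_enum !inE.
Qed.

Lemma metric_basis_ex : exists R, metric_basis e R.
Proof.
rewrite /metric_basis /metric_dim; case: arg_minnP => [|R resR _].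
  by apply/resolvingP=> y z; rewrite mem_enum !inE.
by exists R; rewrite resR /=.
Qed.

(** The complement form of being basis forced when a metric basis omits exactly four vertices. *)
Definition never_removed (f : T) : Prop :=
  forall s, uniq s -> size s = 4 -> separable s -> f \notin s.

Lemma metric_basisP (R : {set T}) : metric_dim e = #|T| - 4 -> 4 <= #|T| ->
  metric_basis e R <-> separable (enum (~: R)) /\ size (enum (~: R)) = 4.
Proof.
move=> dimG n4; have := cardsC R; rewrite /metric_basis dimG -cardE => cRC.
split=> [/andP[/resolvingP sep /eqP cR]|[sep cR]]; first by split=> //; lia.
by apply/andP; split; [apply/resolvingP|apply/eqP; lia].
Qed.

Lemma basis_forcedP (f : T) : metric_dim e = #|T| - 4 -> 4 <= #|T| ->
  reflect (never_removed f) (f \in basis_forced e).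
Proof.
move=> dimG n4; rewrite inE; apply: (iffP forallP) => [forced s us ss sep|nr R].
  have eqs : enum (~: [set x | x \notin s]) =i s by move=> x; rewrite mem_enum !inE negbK.
  have /implyP := forced [set x | x \notin s]; rewrite inE; apply.
  apply/metric_basisP => //; split; first by apply: eq_separable sep.
  by rewrite -ss; apply/perm_size/uniq_perm; rewrite ?enum_uniq.
apply/implyP=> /(metric_basisP _ dimG n4)[sep ss].
by have := nr _ (enum_uniq _) ss sep; rewrite mem_enum inE negbK.
Qed.

(** * Clashing pairs and the exchange argument *)

(** Mostly used with a five-set [s] made of a separable four-set and a forced vertex [f]; its
    classes are then those into which the vertices outside both split the four-set. *)
Definition alike (s : seq T) (y z : T) : bool :=
  [forall w, (w \notin s) ==> (dist w y == dist w z)].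

Lemma alikeP (s : seq T) (y z : T) :
  reflect (forall w, w \notin s -> dist w y = dist w z) (alike s y z).
Proof.
apply: (iffP forallP) => al w; last by apply/implyP=> /al->.
by move=> ws; apply/eqP; apply: (implyP (al w)).
Qed.

Lemma alikeC (s : seq T) (y z : T) : alike s y z = alike s z y.
Proof. by apply: eq_forallb => w; rewrite eq_sym. Qed.

Lemma alike_trans (s : seq T) : transitive (alike s).
Proof.
by move=> z y x /alikeP yz /alikeP zx; apply/alikeP=> w ws; rewrite yz ?zx.
Qed.

Lemma never_removed_clash (f : T) (s : seq T) : never_removed f ->
  uniq s -> size s = 4 -> f \in s ->
  exists y z, [/\ y \in s, z \in s, y != z & alike s y z].
Proof.
move=> nr us ss fs.
case: (boolP [exists y in s, exists z in s, (y != z) && alike s y z]).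
  by case/exists_inP=> y ys /exists_inP[z zs /andP[yz dyz]]; exists y, z.
move=> clash; suff /(nr s us ss) : separable s by rewrite fs.
move=> y z ys zs yz; move/exists_inPn/(_ y ys)/exists_inPn/(_ z zs): clash.
rewrite yz /= => /forallPn[x]; rewrite negb_imply => /andP[xs dx].
by exists x.
Qed.

(** Dropping [x] leaves a four-set through [f], which must contain a clash. The vertices outside
    that four-set are those outside [s] together with [x], hence the two conjuncts of [E]; the
    disjunction lists its six pairs. *)
Lemma exchange (f x p q r : T) (s : seq T) :
  let E y z := alike s y z && (dist x y == dist x z) in
  never_removed f -> uniq s -> perm_eq s [:: f; x; p; q; r] ->
  [|| E f p, E f q, E f r, E p q, E p r | E q r].
Proof.
move=> E nr us ps; have ss := perm_mem ps; rewrite (perm_uniq ps) in us.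
have [|||y [z [ys zs yz /alikeP al]]] := @never_removed_clash f [:: f; p; q; r] nr.
- exact: subseq_uniq (mask_subseq [:: true; false; true; true; true] [:: f; x; p; q; r]) us.
- by [].
- by rewrite mem_head.
have {al} Eyz : E y z.
  apply/andP; split; last by apply/eqP/al; move: us; rewrite /= !inE; do !case: eqVneq => //= _.
  apply/alikeP=> w; rewrite ss => ws; apply: al.
  by move: ws; rewrite !inE; do !case: eqVneq => //= _.
have EC t t' : E t t' = E t' t by rewrite /E alikeC eq_sym.
move: ys zs yz Eyz; rewrite !inE.
by do 2![case/or4P => /eqP->]; rewrite ?eqxx // => _; rewrite 1?EC => ->; rewrite ?orbT.
Qed.

(** Suppose [a], [b], [c] lie in three classes. Dropping [d] puts [f] in the class of one of them,
    say [c], with [d] equidistant from both; dropping [c] then puts [d] in the class of [a] or [b],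
    and dropping that vertex leaves no possible clash. *)
Lemma no_triple (f a b c d : T) (s : seq T) :
  never_removed f -> uniq s -> perm_eq s [:: f; a; b; c; d] ->
  separable [:: a; b; c; d] -> [|| alike s a b, alike s a c | alike s b c].
Proof.
move=> nr us ps0 sep.
(* The only vertex of [s] outside the separable four is [f], so a pair alike over [s] must be
   resolved by [f]. *)
have sepf p q r t : perm_eq s [:: f; p; q; r; t] -> alike s p q -> dist f p != dist f q.
  move=> ps /alikeP al.
  have S4 : [:: a; b; c; d] =i [:: p; q; r; t].
    apply: perm_mem; rewrite -(perm_cons f).
    by apply: perm_trans ps; rewrite perm_sym.
  have [||| x xs dx] := sep p q; rewrite ?S4 ?inE ?eqxx ?orbT //.
    by move: us; rewrite (perm_uniq ps) /= !inE !negb_or => /andP[_ /andP[/andP[]]].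
  have [<-//|xf] := eqVneq x f.
  by rewrite al ?eqxx // (perm_mem ps0) inE negb_or xf in dx.
have tr x y z : alike s x y -> alike s y z -> alike s x z by apply: alike_trans.
(* Here [f] is in the class of [c] and [d] in that of [a]. Dropping [a] leaves only the pair [f],
   [c], and the chain of equal distances then makes [f] equidistant from [a] and [d]. *)
have core2 : forall a b c d, perm_eq s [:: f; a; b; c; d] ->
    ~~ alike s a b -> ~~ alike s a c -> ~~ alike s b c -> alike s f c ->
    dist d f = dist d c -> alike s a d -> dist c a = dist c d -> False.
  move=> {ps0 sep} {}a {}b {}c {}d ps /negP nab /negP nac /negP nbc fc ddf ad dca.
  have da : alike s d a by rewrite alikeC.
  have cf : alike s c f by rewrite alikeC.
  case/or4P: (exchange nr us ps) => [/andP[fb _]|/andP[_ /eqP daf]|/andP[fd _]|].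
  - by apply: nbc; rewrite alikeC; apply: tr fb.
  - suff : dist f a != dist f d by rewrite distC daf distC dca distC -ddf distC eqxx.
    apply: (sepf a d b c) ad.
    by reorder ps.
  - by apply: nac; rewrite alikeC; apply: tr cf (tr _ _ _ fd da).
  case/or3P=> /andP[al _]; first by [].
  - by apply: nab; rewrite alikeC; apply: tr al da.
  by apply: nac; rewrite alikeC; apply: tr al da.
have core : forall a b c d, perm_eq s [:: f; a; b; c; d] ->
    ~~ alike s a b -> ~~ alike s a c -> ~~ alike s b c -> alike s f c ->
    dist d f = dist d c -> False.
  move=> {ps0 sep} {}a {}b {}c {}d ps nab nac nbc fc ddf.
  have cf : alike s c f by rewrite alikeC.
  have ps1 : perm_eq s [:: f; c; a; b; d].
    by reorder ps.
  case/or4P: (exchange nr us ps1) => [/andP[fa _]|/andP[fb _]|/andP[fd /eqP dcf]|].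
  - by apply: (negP nac); rewrite alikeC; apply: tr fa.
  - by apply: (negP nbc); rewrite alikeC; apply: tr fb.
  - suff : dist f c != dist f d by rewrite distC dcf distC -ddf distC eqxx.
    apply: (sepf c d a b) (tr _ _ _ cf fd).
    by reorder ps.
  case/or3P=> /andP[al /eqP dc]; first by rewrite al in nab.
    exact: core2 ps nab nac nbc fc ddf al dc.
  have ps2 : perm_eq s [:: f; b; a; c; d].
    by reorder ps.
  by apply: core2 ps2 _ nbc nac fc ddf al dc; rewrite alikeC.
have ps1 : perm_eq s [:: f; d; a; b; c].
  by reorder ps0.
apply/negPn/negP; rewrite !negb_or => /and3P[nab nac nbc].
case/or4P: (exchange nr us ps1) => [/andP[fa /eqP dd]|/andP[fb /eqP dd]|/andP[fc /eqP dd]|].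
- have ps2 : perm_eq s [:: f; b; c; a; d].
    by reorder ps0.
  by apply: core ps2 nbc _ _ fa dd; rewrite alikeC.
- have ps2 : perm_eq s [:: f; a; c; b; d].
    by reorder ps0.
  by apply: core ps2 nac nab _ fb dd; rewrite alikeC.
- exact: core ps0 nab nac nbc fc dd.
by rewrite (negPf nab) (negPf nac) (negPf nbc).
Qed.

(** By [no_triple], [u] and [v] each give at most two classes on [s]. A pair alike for both would be
    resolved by no vertex outside [s], so a class of one partition meets a class of the other in at
    most one vertex; both therefore have two classes of size two, and they cross. *)
Lemma crossing (u v : T) (s : seq T) :
  never_removed u -> never_removed v -> uniq [:: u, v & s] -> size s = 4 ->
  separable s ->
  exists a b c d, [/\ perm_eq s [:: a; b; c; d], alike (u :: s) a b,
    alike (u :: s) c d, alike (v :: s) a c & alike (v :: s) b d].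
Proof.
move=> nu nv uniqs ss sep.
have us : uniq (u :: s).
  by move: uniqs; rewrite /= inE negb_or => /and3P[/andP[_ ->] _].
have vs : uniq (v :: s) by case/andP: uniqs.
have uv : u != v by move: uniqs; rewrite /= inE negb_or => /andP[/andP[]].
have sepP a b c d : perm_eq s [:: a; b; c; d] -> separable [:: a; b; c; d].
  by move=> ps; apply: eq_separable sep; apply: perm_mem.
have triu a b c d : perm_eq s [:: a; b; c; d] ->
    [|| alike (u :: s) a b, alike (u :: s) a c | alike (u :: s) b c].
  by move=> ps; apply: (@no_triple u a b c d) => //; [rewrite perm_cons|apply: sepP].
have triv a b c d : perm_eq s [:: a; b; c; d] ->
    [|| alike (v :: s) a b, alike (v :: s) a c | alike (v :: s) b c].
  by move=> ps; apply: (@no_triple v a b c d) => //; [rewrite perm_cons|apply: sepP].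
have both a b c d : perm_eq s [:: a; b; c; d] -> alike (u :: s) a b -> ~~ alike (v :: s) a b.
  move=> ps /alikeP au; apply/negP => /alikeP av.
  have [||| x xs /eqP[]] := sep a b; rewrite ?(perm_mem ps) ?inE ?eqxx ?orbT //.
    move: us; rewrite -(perm_cons u) in ps; rewrite (perm_uniq ps) /= !inE !negb_or.
    by case/andP=> _ /andP[/andP[]].
  have [->|xu] := eqVneq x u; last by apply: au; rewrite inE negb_or xu.
  by apply: av; rewrite inE negb_or uv; case/andP: us.
have tru x y z : alike (u :: s) x y -> alike (u :: s) y z -> alike (u :: s) x z.
  exact: alike_trans.
have trv x y z : alike (v :: s) x y -> alike (v :: s) y z -> alike (v :: s) x z.
  exact: alike_trans.
have core a b c d : perm_eq s [:: a; b; c; d] -> alike (u :: s) a b -> alike (v :: s) a c ->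
    alike (u :: s) c d /\ alike (v :: s) b d.
  move=> ps uab vac.
  have vbc : ~~ alike (v :: s) b c.
    by apply: contra (both _ _ _ _ ps uab) => vbc; apply: trv vac _; rewrite alikeC.
  have uac : ~~ alike (u :: s) a c.
    apply: contraL vac; apply: (both a c b d).
    by reorder ps.
  have ubc : ~~ alike (u :: s) b c by apply: contra uac; apply: tru.
  have ps2 : perm_eq s [:: b; c; d; a] by reorder ps.
  have ps3 : perm_eq s [:: a; d; b; c] by reorder ps.
  have ps4 : perm_eq s [:: c; d; a; b] by reorder ps.
  have ps5 : perm_eq s [:: b; d; a; c] by reorder ps.
  have vbd : alike (v :: s) b d.
    case/or3P: (triv _ _ _ _ ps2) => [vbc'|//|vcd]; first by rewrite vbc' in vbc.
    case/or3P: (triu _ _ _ _ ps2) => [ubc'|ubd|ucd]; first by rewrite ubc' in ubc.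
      by have := both _ _ _ _ ps3 (tru _ _ _ uab ubd); rewrite (trv _ _ _ vac vcd).
    by have := both _ _ _ _ ps4 ucd; rewrite vcd.
  split=> //; case/or3P: (triu _ _ _ _ ps4) => [//|uca|uda].
    by rewrite alikeC uca in uac.
  by have := both _ _ _ _ ps5; rewrite vbd alikeC => /(_ (tru _ _ _ uda uab)).
have base a b c d : perm_eq s [:: a; b; c; d] -> alike (u :: s) a b ->
  exists a b c d, [/\ perm_eq s [:: a; b; c; d], alike (u :: s) a b,
    alike (u :: s) c d, alike (v :: s) a c & alike (v :: s) b d].
  move=> ps uab; case/or3P: (triv _ _ _ _ ps) => [vab|vac|vbc].
  - by have := both _ _ _ _ ps uab; rewrite vab.
  - by have [ucd vbd] := core _ _ _ _ ps uab vac; exists a, b, c, d.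
  have ps1 : perm_eq s [:: b; a; c; d] by reorder ps.
  have uba : alike (u :: s) b a by rewrite alikeC.
  by have [ucd vbd] := core _ _ _ _ ps1 uba vbc; exists b, a, c, d.
case: s ss {us vs sep uniqs} => [|a [|b [|c [|d []]]]] //= _
  in sepP triu triv both tru trv core base *.
have ps := perm_refl [:: a; b; c; d].
case/or3P: (triu _ _ _ _ ps) => [uab|uac|ubc]; first exact: base uab.
  by apply: (base a c b d) uac; reorder ps.
by apply: (base b c a d) ubc; reorder ps.
Qed.


(** * Quads: four vertices named by their distances to two forced vertices *)

Lemma separable_map (r s : seq T) : all [predC s] r ->
  {in s &, injective (fun x => [seq dist w x | w <- r])} -> separable s.
Proof.
move=> /allP rs inj y z ys zs yz.
have [/hasP[w wr dw]|/hasPn al] := boolP (has (fun w => dist w y != dist w z) r).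
  by exists w; first exact: rs.
case/eqP: yz; apply: inj => //; apply/eq_in_map => w /al.
by rewrite negbK => /eqP.
Qed.

(* The strict inequalities only fix the naming of the four vertices. *)
Definition quad (u v a b c d : T) : Prop :=
  [/\ uniq [:: u; v; a; b; c; d],
      [/\ dist u a = dist u b, dist u c = dist u d & dist u a < dist u c]
    & [/\ dist v a = dist v c, dist v b = dist v d & dist v a < dist v b]].

Lemma quadC (u v a b c d : T) : quad u v a b c d -> quad v u a c b d.
Proof.
case=> us hu hv; split=> //; rewrite -(perm_uniq (_ : perm_eq [:: u; v; a; b; c; d] _)) //.
by apply/permP => ? /=; ring.
Qed.

Lemma uniq6 (u v a b c d : T) : uniq [:: u; v; a; b; c; d] ->
  u \notin [:: a; b; c; d] /\ v \notin [:: a; b; c; d].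
Proof. by rewrite /= [u \in _]inE negb_or => /and3P[/andP[_ ->] ->]. Qed.

(** The four pairs of distances to [u] and [v] are distinct, so these two vertices suffice to
    resolve the quad. *)
Lemma quad_separable (u v a b c d : T) : quad u v a b c d -> separable [:: a; b; c; d].
Proof.
case=> /uniq6[us vs] [uab ucd luac] [vac vbd lvab].
apply: (@separable_map [:: u; v]) => [|y z]; first by rewrite /= us vs.
rewrite !inE.
by do 2![case/or4P => /eqP->]; rewrite //= => -[]; lia.
Qed.

Lemma alike_separable (f x y : T) (s : seq T) : separable s ->
  x \in s -> y \in s -> x != y -> alike (f :: s) x y -> dist f x != dist f y.
Proof.
move=> sep xs ys xy /alikeP al; have [z zs dz] := sep x y xs ys xy.
have [<-//|zf] := eqVneq z f.
by rewrite al ?eqxx // inE negb_or zf in dz.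
Qed.

(** A pair alike over [u :: s] is one that [u] alone resolves, so the classes of equal distance from
    [u] are the pairs alike over [v :: s], and conversely. A vertex outside all six respects both
    partitions, hence is constant on [s]. *)
Lemma quad_of_separable (u v : T) (s : seq T) :
  never_removed u -> never_removed v -> uniq [:: u, v & s] -> size s = 4 ->
  separable s ->
  (exists a b c d, perm_eq s [:: a; b; c; d] /\ quad u v a b c d) /\
  (forall w, w \notin [:: u, v & s] -> {in s &, forall x y, dist w x = dist w y}).
Proof.
move=> nu nv uniqs ss sep.
have [a [b [c [d [ps uab ucd vac vbd]]]]] := crossing nu nv uniqs ss sep.
have uniqp p q r t : perm_eq s [:: p; q; r; t] -> uniq [:: u; v; p; q; r; t].
  by move=> ps'; rewrite -(perm_uniq (_ : perm_eq [:: u, v & s] _)) ?perm_cons.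
have neq : (a != b) && (a != c).
  have := uniqp _ _ _ _ ps; rewrite /= !inE !negb_or.
  by case/and4P=> _ _ /and3P[-> ->].
case/andP: neq => nab nac.
have duab : dist u a != dist u b.
  by apply: alike_separable nab uab => //; rewrite (perm_mem ps) !inE eqxx ?orbT.
have dvac : dist v a != dist v c.
  by apply: alike_separable nac vac => //; rewrite (perm_mem ps) !inE eqxx ?orbT.
have [us vs] : u \notin v :: s /\ v \notin u :: s.
  by move: uniqs; rewrite /= !inE !negb_or eq_sym => /and3P[/andP[-> ->] ->].
move: uab ucd vac vbd => /alikeP uab /alikeP ucd /alikeP vac /alikeP vbd.
have := (vac _ us, vbd _ us, (uab _ vs, ucd _ vs)) => -[[duac dubd] [dvab dvcd]].
split; last first.
  move=> w; rewrite 2!inE !negb_or => /and3P[wu wv ws].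
  have {}uab := uab w; have {}vac := vac w; have {}vbd := vbd w.
  move: uab vac vbd; rewrite !inE !negb_or wu wv ws => /(_ isT) uab /(_ isT) vac /(_ isT) vbd.
  move=> x y; rewrite !(perm_mem ps) !inE.
  by do 2![case/or4P => /eqP->]; congruence.
(* Which class is nearer to [u] and which is nearer to [v] decides among four namings. *)
have [lu|lu] := ltnP (dist u a) (dist u b); have [lv|lv] := ltnP (dist v a) (dist v c).
- have ps' : perm_eq s [:: a; c; b; d] by reorder ps.
  by exists a, c, b, d; split=> //; split; [exact: uniqp| |];
    clear - lu lv duab dvac duac dubd dvab dvcd; split; lia.
- have ps' : perm_eq s [:: c; a; d; b] by reorder ps.
  by exists c, a, d, b; split=> //; split; [exact: uniqp| |];
    clear - lu lv duab dvac duac dubd dvab dvcd; split; lia.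
- have ps' : perm_eq s [:: b; d; a; c] by reorder ps.
  by exists b, d, a, c; split=> //; split; [exact: uniqp| |];
    clear - lu lv duab dvac duac dubd dvab dvcd; split; lia.
have ps' : perm_eq s [:: d; b; c; a] by reorder ps.
by exists d, b, c, a; split=> //; split; [exact: uniqp| |];
    clear - lu lv duab dvac duac dubd dvab dvcd; split; lia.
Qed.

(** * Vertices outside a quad are twins of its members *)

Lemma quad_const (u v a b c d w x y : T) : never_removed u -> never_removed v ->
  quad u v a b c d -> w \notin [:: u; v; a; b; c; d] ->
  x \in [:: a; b; c; d] -> y \in [:: a; b; c; d] -> dist w x = dist w y.
Proof.
move=> nu nv q ws xs ys; have sep := quad_separable q; have [us _ _] := q.
by have [_] := quad_of_separable nu nv us erefl sep; apply.
Qed.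

(** If [u] saw [w] at a third distance, replacing [a] by [w] would give a separable four-set on
    which [u] takes three values, against the two allowed by [quad_of_separable]. *)
Lemma quad_type_l (u v a b c d w : T) : never_removed u -> never_removed v ->
  quad u v a b c d -> w \notin [:: u; v; a; b; c; d] ->
  dist u w = dist u a \/ dist u w = dist u c.
Proof.
move=> nu nv q ws; have [us [uab ucd uac] [vac vbd vab]] := q.
have [/eqP ->|wa] := boolP (dist u w == dist u a); first by left.
have [/eqP ->|wc] := boolP (dist u w == dist u c); first by right.
have us' : uniq [:: u; v; w; b; c; d].
  have us7 : uniq [:: u; v; w; a; b; c; d].
    rewrite (perm_uniq (_ : perm_eq _ (w :: [:: u; v; a; b; c; d]))) ?[uniq _]/= ?ws //.
    by apply/permP => ? /=; ring.
  pose m := [:: true; true; true; false; true; true; true].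
  exact: subseq_uniq (mask_subseq m [:: u; v; w; a; b; c; d]) us7.
have [unw vnw] := uniq6 us'.
have sep : separable [:: w; b; c; d].
  apply: (@separable_map [:: u; v]) => [|y z]; first by rewrite /= unw vnw.
  rewrite !inE /=.
  clear - wa wc uab ucd uac vac vbd vab.
  by do 2![case/or4P => /eqP->]; rewrite //= => -[]; lia.
have [[a' [b' [c' [d' [ps [_ [uab' ucd' _] _]]]]]] _] :=
  quad_of_separable nu nv us' erefl sep.
have val x : x \in [:: w; b; c; d] -> dist u x = dist u a' \/ dist u x = dist u c'.
  by rewrite (perm_mem ps) !inE => /or4P[] /eqP->; rewrite -?uab' -?ucd'; [left|left|right|right].
have := (val w, val b, val c); rewrite !inE !eqxx ?orbT.
case=> [[/(_ isT) vw /(_ isT) vb] /(_ isT) vc].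
clear - wa wc uac uab vw vb vc; lia.
Qed.


(** Applying [quad_type_l] to [u] and, through [quadC], to [v] gives [w] the distance pair of one
    member [s], whose place it can take. *)
Lemma quad_replace (u v a b c d w : T) : never_removed u -> never_removed v ->
  quad u v a b c d -> w \notin [:: u; v; a; b; c; d] ->
  exists s r, [/\ perm_eq [:: a; b; c; d] (s :: r),
    dist u w = dist u s, dist v w = dist v s &
    exists a' b' c' d', perm_eq (w :: r) [:: a'; b'; c'; d'] /\ quad u v a' b' c' d'].
Proof.
move=> nu nv q ws; have [us [uab ucd uac] [vac vbd vab]] := q.
have ws' : w \notin [:: v; u; a; c; b; d].
  by rewrite (perm_mem (_ : perm_eq _ [:: u; v; a; b; c; d])) //; apply/permP => ? /=; ring.
have uw := quad_type_l nu nv q ws; have vw := quad_type_l nv nu (quadC q) ws'.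
have new r a' b' c' d' s : perm_eq (w :: r) [:: a'; b'; c'; d'] ->
    perm_eq [:: a; b; c; d] (s :: r) -> uniq [:: u; v; a'; b'; c'; d'].
  move=> ps pr.
  have usw : uniq (s :: [:: u; v; a'; b'; c'; d']).
    rewrite (perm_uniq (_ : perm_eq _ (w :: [:: u; v; a; b; c; d]))) ?[uniq _]/= ?ws //.
    apply/permP => P; have /permP/(_ P) := ps; have /permP/(_ P) := pr.
    clear; rewrite /=; do ![move: (nat_of_bool (P _))] => *; lia.
  by case/andP: usw.
case: uw vw => [uwa|uwc] [vwa|vwb].
- have ps : perm_eq [:: a; b; c; d] (a :: [:: b; c; d]) by [].
  exists a, [:: b; c; d]; split=> //; exists w, b, c, d; split=> //.
  by split; [exact: new ps| |]; clear - uab ucd uac vac vbd vab uwa vwa; split; lia.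
- have ps : perm_eq [:: a; b; c; d] (b :: [:: a; c; d]) by apply/permP => ? /=; ring.
  have ps' : perm_eq (w :: [:: a; c; d]) [:: a; w; c; d] by apply/permP => ? /=; ring.
  exists b, [:: a; c; d]; split=> //; [lia|exists a, w, c, d; split=> //].
  by split; [exact: new ps| |]; clear - uab ucd uac vac vbd vab uwa vwb; split; lia.
- have ps : perm_eq [:: a; b; c; d] (c :: [:: a; b; d]) by apply/permP => ? /=; ring.
  have ps' : perm_eq (w :: [:: a; b; d]) [:: a; b; w; d] by apply/permP => ? /=; ring.
  exists c, [:: a; b; d]; split=> //; [lia|exists a, b, w, d; split=> //].
  by split; [exact: new ps| |]; clear - uab ucd uac vac vbd vab uwc vwa; split; lia.
have ps : perm_eq [:: a; b; c; d] (d :: [:: a; b; c]) by apply/permP => ? /=; ring.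
have ps' : perm_eq (w :: [:: a; b; c]) [:: a; b; c; w] by apply/permP => ? /=; ring.
exists d, [:: a; b; c]; split=> //; [lia|lia|exists a, b, c, w; split=> //].
by split; [exact: new ps| |]; clear - uab ucd uac vac vbd vab uwc vwb; split; lia.
Qed.

(** [quad_const] is used twice: [w] lies outside the old quad, and [s] lies outside the quad in
    which [w] has replaced it. *)
Lemma quad_twin (u v a b c d w : T) : never_removed u -> never_removed v ->
  quad u v a b c d -> w \notin [:: u; v; a; b; c; d] ->
  exists2 s, s \in [:: a; b; c; d] &
    [/\ dist u w = dist u s, dist v w = dist v s &
        forall t, t \in [:: a; b; c; d] -> t != s ->
          dist w t = dist w s /\ dist s t = dist w s].
Proof.
move=> nu nv q ws; have [us _ _] := q.
have [s [r [ps uw vw [a' [b' [c' [d' [ps' q']]]]]]]] := quad_replace nu nv q ws.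
have sS : s \in [:: a; b; c; d] by rewrite (perm_mem ps) mem_head.
exists s => //; split=> // t tS ts; split; first exact: quad_const ws _ _.
have tr : t \in r by move: tS; rewrite (perm_mem ps) inE (negPf ts).
rewrite [RHS]distC; apply: quad_const nu nv q' _ _ _.
- have usr : uniq (u :: v :: s :: r).
    by rewrite -(perm_uniq (_ : perm_eq [:: u; v; a; b; c; d] _)) ?perm_cons.
  have sw : s != w.
    by apply: contraNneq ws => <-; rewrite !inE in sS *; rewrite sS !orbT.
  move: usr; rewrite /= 2![s \in _ :: _]inE -(perm_mem ps') !inE !negb_or ![s == _]eq_sym.
  by case/and4P=> /and3P[_ -> _] /andP[-> _] -> _; rewrite eq_sym sw.
- by rewrite -(perm_mem ps') inE tr orbT.
by rewrite -(perm_mem ps') mem_head.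
Qed.

(* A geodesic step leaving the six vertices can be redirected to a twin, so they
   carry the metric of their induced subgraph. *)
Lemma quad_step (u v a b c d x y : T) : never_removed u -> never_removed v ->
  quad u v a b c d -> x \in [:: u; v; a; b; c; d] -> y \in [:: u; v; a; b; c; d] ->
  1 < dist x y ->
  exists2 z, z \in [:: u; v; a; b; c; d] & dist x z = 1 /\ dist z y = (dist x y).-1.
Proof.
move=> nu nv q xs ys dxy.
have [xy|/dist_step[z xz dzy]] := eqVneq x y; first by rewrite xy distxx in dxy.
have {}xz : dist x z = 1 by apply/eqP; rewrite dist_eq1.
have [zs|zs] := boolP (z \in [:: u; v; a; b; c; d]); first by exists z.
have [s sS [us vs tS]] := quad_twin nu nv q zs.
have eqd t : t \in [:: u; v; a; b; c; d] -> t != s -> dist z t = dist s t.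
  rewrite 2!inE => /or3P[/eqP->|/eqP->|tS'] ts.
  - by rewrite distC us distC.
  - by rewrite distC vs distC.
  by have [-> ->] := tS t tS' ts.
have sS' : s \in [:: u; v; a; b; c; d] by rewrite 2!inE sS !orbT.
(* If [x] is the twin, [z] would be no closer to [y] than [x] is; if [y] is the twin, [x] and [y]
   would be adjacent. Otherwise the twin serves in place of [z]. *)
have [xs'|xs'] := eqVneq x s.
  have ys' : y != s by apply: contraTneq dxy => ->; rewrite xs' distxx.
  by move: dzy; rewrite (eqd y) // -xs'; lia.
have [ys'|ys'] := eqVneq y s.
  by move: xz dxy; rewrite distC (eqd x) // -ys' distC => ->.
by exists s => //; rewrite [dist x s]distC -!eqd // distC.
Qed.

(* Vertices taken from distinct layers around x are resolved by x. *)
Lemma dist_le3 (u v x y : T) : never_removed u -> never_removed v -> u != v ->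
  dist x y <= 3.
Proof.
move=> nu nv uv; rewrite leqNgt; apply/negP => xy4.
(* The forced vertex must differ from [x], which has to stay outside the four-set to resolve it.
   Three of the layers 1 to 4 avoid the layer of [f]. *)
have [f fx nf] : exists2 f, f != x & never_removed f.
  by have [ux|] := eqVneq u x; [exists v; rewrite // eq_sym -ux|exists u].
have layer k : k <= 4 -> exists z, dist x z = k.
  by move=> k4; apply: (@dist_layer x y); apply: leq_trans xy4.
have [[p1 d1] [p2 d2] [p3 d3] [p4 d4]] :=
  And4 (layer 1 isT) (layer 2 isT) (layer 3 isT) (layer 4 isT).
have no s : size s = 4 -> uniq (map (dist x) s) -> 0 \notin map (dist x) s -> f \in s -> False.
  move=> ss us s0 fs.
  suff sep : separable s by have := nf s (map_uniq us) ss sep; rewrite fs.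
  move=> y' z' ys zs yz; exists x.
    by apply: contra s0 => xs; apply/mapP; exists x; rewrite ?distxx.
  by apply: contra_neq yz => /(uniq_map_inj us); apply.
have f0 : dist x f != 0 by rewrite dist_eq0 eq_sym.
have [f1|f1] := eqVneq (dist x f) 1.
  by apply: (no [:: f; p2; p3; p4]); rewrite ?mem_head //= d2 d3 d4 f1.
have [f2|f2] := eqVneq (dist x f) 2.
  by apply: (no [:: f; p1; p3; p4]); rewrite ?mem_head //= d1 d3 d4 f2.
have [f3|f3] := eqVneq (dist x f) 3.
  by apply: (no [:: f; p1; p2; p4]); rewrite ?mem_head //= d1 d2 d4 f3.
apply: (no [:: f; p1; p2; p3]); rewrite ?mem_head //= d1 d2 d3 !inE !negb_or ?f1 ?f2 ?f3 //.
by rewrite eq_sym f0.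
Qed.

(** * Transfer of the finite search to quads *)

Definition quad_distances (u v a b c d : T) : seq nat :=
  [:: dist u a; dist u c; dist v a; dist v b; dist u v;
      dist a b; dist a c; dist a d; dist b c; dist b d; dist c d].

Lemma quad_dist (u v a b c d : T) : quad u v a b c d ->
  let h := [:: a; b; c; d; u; v] in
  {in iota 0 6 &, forall i j,
     hex_dist (quad_distances u v a b c d) i j = dist (nth u h i) (nth u h j)}.
Proof.
case=> _ [uab ucd _] [vac vbd _] h i j; rewrite !mem_iota /= !add0n.
case: i => [|[|[|[|[|[|i]]]]]] //= _;
case: j => [|[|[|[|[|[|j]]]]]] //= _;
by rewrite ?distxx // distC // -?uab -?ucd -?vac -?vbd // distC.
Qed.

(** The entries are at most 3 by [dist_le3], [quad_step] supplies [hex_steps], and the two forced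
    vertices supply [hex_forced]. *)
Lemma quad_classification (u v a b c d : T) :
  never_removed u -> never_removed v -> quad u v a b c d ->
  [/\ dist u a = 1, dist u c = 2, dist v a = 1, dist v b = 2 &
      {in [:: a; b; c; d] &, forall x y, x != y -> e x y} \/
      quad_distances u v a b c d = G3_distances].
Proof.
move=> nu nv q; have [us [uab ucd uac] [vac vbd vab]] := q.
pose h := [:: a; b; c; d; u; v]; pose p := nth u h.
pose qs := quad_distances u v a b c d.
have D : {in iota 0 6 &, forall i j, hex_dist qs i j = dist (p i) (p j)} := quad_dist q.
have uh : uniq h.
  rewrite -(perm_uniq (_ : perm_eq [:: u; v; a; b; c; d] _)) //.
  by apply/permP => ? /=; ring.
have hE : [:: u; v; a; b; c; d] =i h.
  by apply: perm_mem; apply/permP => ? /=; ring.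
have p_mem i : i \in iota 0 6 -> p i \in [:: u; v; a; b; c; d].
  by rewrite mem_iota hE => /andP[_ i6]; apply: mem_nth.
have p_inj : {in iota 0 6 &, injective p}.
  move=> i j; rewrite !mem_iota => /andP[_ i6] /andP[_ j6] /eqP.
  by rewrite nth_uniq // => /eqP.
have p_ex x : x \in [:: u; v; a; b; c; d] -> exists2 i, i \in iota 0 6 & x = p i.
  by rewrite hE => /(nthP u)[i i6 <-]; exists i; rewrite // mem_iota.
have rng i j : i \in iota 0 6 -> j \in iota 0 6 -> i != j -> 0 < dist (p i) (p j) <= 3.
  move=> i6 j6 ij; rewrite (dist_le3 _ _ nu nv) ?andbT; last first.
    by move: us; rewrite /= inE negb_or => /andP[/andP[]].
  by rewrite lt0n dist_eq0; apply: contra_neq ij; apply: p_inj.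
(* A clashing pair is equidistant from every vertex outside the four-set, in particular from the two
   remaining points of the six. *)
have clash f : f \in iota 0 6 -> never_removed (p f) -> hex_forced (hex_dist qs) f.
  move=> f6 nf; apply/allP=> i i6; apply/allP=> j j6; apply/allP=> k k6; apply/implyP=> us4.
  have s6 t : t \in [:: f; i; j; k] -> t \in iota 0 6.
    by move: f6 i6 j6 k6; rewrite !inE => ? ? ? ? /or4P[] /eqP->.
  have inj4 : {in [:: f; i; j; k] &, injective p}.
    by move=> t t' /s6 t6 /s6 t6'; apply: p_inj.
  have [|||_ [_ [/mapP[y ys ->] /mapP[z zs ->] yz /alikeP al]]] :=
    never_removed_clash (s := map p [:: f; i; j; k]) nf.
  - by rewrite map_inj_in_uniq.
  - by rewrite size_map.
  - exact: mem_head.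
  apply/hasP; exists y => //; apply/hasP; exists z => //.
  apply/andP; split; first by apply: contra_neq yz => ->.
  apply/allP=> t t6; apply/implyP=> ts; rewrite !D ?(s6 y ys) ?(s6 z zs) //; apply/eqP; apply: al.
  by apply: contra ts => /mapP[t' ts' /p_inj ->] //; apply: s6.
have steps : hex_steps (hex_dist qs).
  apply/allP=> i i6; apply/allP=> j j6; apply/implyP; rewrite D // => dij.
  have [z /p_ex[k k6 ->] [dik dkj]] := quad_step nu nv q (p_mem i i6) (p_mem j j6) dij.
  by apply/hasP; exists k; rewrite // !D // dik dkj !eqxx.
have := @hex_classification qs erefl; case.
- rewrite /= (rng 4 0) // (rng 4 2) // (rng 5 0) // (rng 5 1) // (rng 4 5) // (rng 0 1) //.
  by rewrite (rng 0 2) // (rng 0 3) // (rng 1 2) // (rng 1 3) // (rng 2 3).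
- by apply/and5P; split=> //; apply: clash.
case=> ua uc va vb cl; split=> //; case: cl => [[ab ac ad bc bd cd]|cl]; [left|right].
  move=> x y; rewrite !inE.
  by do 2![case/or4P => /eqP->]; rewrite ?eqxx // => _; rewrite -dist_eq1 1?distC;
     rewrite ?ab ?ac ?ad ?bc ?bd ?cd // distC ?ab ?ac ?ad ?bc ?bd ?cd.
by rewrite -/qs -(cat_take_drop 4 qs) cl /= ua uc va vb.
Qed.

(** * Recognition of $G_3$ *)

(** With positions as names, the edges of $G_3$ are the entries 1 of the table, so adjacency is
    compared by computation. *)
Lemma is_G3P (u v : T) :
  is_G3 e u v <->
  exists a b c d, let h := [:: a; b; c; d; u; v] in
    [/\ uniq h, forall x, x \in h &
        {in iota 0 6 &, forall i j,
          e (nth u h i) (nth u h j) = (hex_dist G3_distances i j == 1)}].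
Proof.
have key a b c d : uniq [:: a; b; c; d; u; v] ->
    let h := [:: a; b; c; d; u; v] in
    {in iota 0 6 &, forall i j, let x := nth u h i in let y := nth u h j in
    let E := [:: (c, d); (d, b); (b, a); (a, c); (c, b);
                 (v, c); (v, a); (u, a); (u, b); (u, v)] in
    ((x, y) \in E) || ((y, x) \in E) = (hex_dist G3_distances i j == 1)}.
  move=> uh h i j; rewrite !mem_iota => /andP[_ i6] /andP[_ j6].
  set E := [:: (c, d); _; _; _; _; _; _; _; _; _].
  have eqn k l : k < 6 -> l < 6 -> (nth u h k == nth u h l) = (k == l).
    by move=> k6 l6; rewrite nth_uniq.
  (* The edge list [E] with each vertex replaced by its position in [h]. *)
  pose E' := [:: (2, 3); (3, 1); (1, 0); (0, 2); (2, 1); (5, 2); (5, 0); (4, 0); (4, 1); (4, 5)].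
  have inE' k l : k < 6 -> l < 6 -> ((nth u h k, nth u h l) \in E) = ((k, l) \in E').
    move=> k6 l6; have -> : E = [seq (nth u h t.1, nth u h t.2) | t <- E'] by [].
    apply/mapP/idP => [[[k' l'] kl' /= [/eqP ek /eqP el]]|kl]; last by exists (k, l).
    have /andP[k'6 l'6] : (k' < 6) && (l' < 6).
      by move: kl'; apply: (allP (_ : all (fun t => (t.1 < 6) && (t.2 < 6)) E')).
    by rewrite !eqn // in ek el; rewrite (eqP ek) (eqP el).
  rewrite !inE' //.
  clear - i6 j6; case: i i6 => [|[|[|[|[|[|i]]]]]] // _;
  by case: j j6 => [|[|[|[|[|[|j]]]]]].
split=> [[c [d [b [a [/= uh Th Ee]]]]]|[a [b [c [d [/= uh Th Ee]]]]]].
  have ph : perm_eq [:: c; d; b; a; u; v] [:: a; b; c; d; u; v].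
    by apply/permP => ? /=; ring.
  have uh' : uniq [:: a; b; c; d; u; v] by rewrite -(perm_uniq ph).
  exists a, b, c, d; split=> //; first by move=> x; rewrite -(perm_mem ph) Th.
  by move=> i j i6 j6; rewrite Ee; apply: key.
have ph : perm_eq [:: a; b; c; d; u; v] [:: c; d; b; a; u; v].
  by apply/permP => ? /=; ring.
exists c, d, b, a; split; first by rewrite -(perm_uniq ph).
  by move=> x; rewrite -(perm_mem ph).
move=> x y; have /(nthP u)[i i6 <-] := Th x; have /(nthP u)[j j6 <-] := Th y.
have {}i6 : i \in iota 0 6 by rewrite mem_iota add0n.
have {}j6 : j \in iota 0 6 by rewrite mem_iota add0n.
by rewrite Ee // -(key a b c d).
Qed.

(* A twin w of b makes {u, v, a, b} separable, resolved by c, d and w. *)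
Lemma quad_G3_twin (u v a b c d w : T) :
  never_removed u -> never_removed v -> quad u v a b c d ->
  quad_distances u v a b c d = G3_distances -> w \notin [:: u; v; a; b; c; d] ->
  dist u w = dist u b -> dist v w = dist v b ->
  {in [:: a; b; c; d], forall t, dist w t = 1} -> False.
Proof.
move=> nu nv [us [uab ucd _] [vac vbd _]] [ua uc va vb _ ab ac ad bc bd cd] ws uw vw wt.
have us7 : uniq (w :: [:: u; v; a; b; c; d]) by rewrite [uniq _]/= ws.
have us4 : uniq [:: u; v; a; b].
  exact: subseq_uniq (mask_subseq [:: false; true; true; true; true] [:: w; u; v; a; b; c; d]) us7.
suff /(nu _ us4 erefl) : separable [:: u; v; a; b] by rewrite mem_head.
apply: (@separable_map [:: c; d; w]).
  have us7' : uniq ([:: u; v; a; b] ++ [:: c; d; w]).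
    by rewrite -(perm_uniq (_ : perm_eq [:: w; u; v; a; b; c; d] _)) //; apply/permP => ? /=; ring.
  apply/allP=> x xr; move: us7'; rewrite cat_uniq => /and3P[_ /hasPn/(_ x xr)].
  by [].
have [wa wb] : dist w a = 1 /\ dist w b = 1 by rewrite !wt // !inE eqxx ?orbT.
have [wu wv] : dist w u = 1 /\ dist w v = 2 by rewrite ![dist w _]distC uw vw -uab ua vb.
have [cu cv] : dist c u = 2 /\ dist c v = 1 by rewrite ![dist c _]distC uc -vac va.
have [du dv] : dist d u = 2 /\ dist d v = 2 by rewrite ![dist d _]distC -ucd uc -vbd vb.
have [ca cb] : dist c a = 1 /\ dist c b = 1 by rewrite ![dist c _]distC ac bc.
have [da db] : dist d a = 2 /\ dist d b = 1 by rewrite ![dist d _]distC ad bd.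
move=> x y; rewrite !inE.
by do 2![case/or4P => /eqP->]; rewrite //= ?wa ?wb ?wu ?wv ?cu ?cv ?du ?dv ?ca ?cb ?da ?db.
Qed.

(** A seventh vertex would be a twin of a member that is equidistant from the other three. This
    fails for [a] and [d], at distance 2 from each other but 1 from [b]; [quad_G3_twin] excludes [b]
    and [c]. *)
Lemma quad_G3 (u v a b c d : T) :
  never_removed u -> never_removed v -> quad u v a b c d ->
  quad_distances u v a b c d = G3_distances -> is_G3 e u v.
Proof.
move=> nu nv q dG; have [us _ _] := q; have [ua uc va vb uv ab ac ad bc bd cd] := dG.
have ph : perm_eq [:: u; v; a; b; c; d] [:: a; b; c; d; u; v].
  by apply/permP => ? /=; ring.
have mem4 i : i < 4 -> nth u [:: a; b; c; d] i \in [:: a; b; c; d].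
  by move=> i4; rewrite mem_nth.
have neq x y : dist x y != 0 -> x != y by rewrite dist_eq0.
have all6 w : w \in [:: u; v; a; b; c; d].
  apply/negPn/negP => ws; have [s sS [uw vw tw]] := quad_twin nu nv q ws.
  move: sS uw vw tw; rewrite 2!inE !inE => /or4P[] /eqP-> uw vw tw.
  - have [_ da] := tw d (mem4 3 isT) (neq d a ltac:(by rewrite distC ad)).
    have [_] := tw b (mem4 1 isT) (neq b a ltac:(by rewrite distC ab)).
    by rewrite ab -da ad.
  - have [_ ba] := tw a (mem4 0 isT) (neq a b ltac:(by rewrite ab)).
    apply: (quad_G3_twin nu nv q dG ws uw vw) => t tS.
    have wb : dist w b = 1 by rewrite -ba distC ab.
    by have [->//|tb] := eqVneq t b; have [-> _] := tw t tS tb.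
  (* The table is invariant under exchanging [u] with [v] and [b] with [c], which reduces this case
     to the previous one. *)
  - have [_ ca] := tw a (mem4 0 isT) (neq a c ltac:(by rewrite ac)).
    apply: (quad_G3_twin (w := w) nv nu (quadC q)) => //.
    + by rewrite /quad_distances va vb ua uc distC uv ac ab ad distC bc cd bd.
    + by rewrite (perm_mem (_ : perm_eq _ [:: u; v; a; b; c; d])) //; apply/permP => ? /=; ring.
    move=> t; rewrite (perm_mem (_ : perm_eq _ [:: a; b; c; d])); last first.
      by apply/permP => ? /=; ring.
    have wc : dist w c = 1 by rewrite -ca distC ac.
    by move=> tS; have [->//|tc] := eqVneq t c; have [-> _] := tw t tS tc.
  have [_ da] := tw a (mem4 0 isT) (neq a d ltac:(by rewrite ad)).
  have [_] := tw b (mem4 1 isT) (neq b d ltac:(by rewrite bd)).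
  by rewrite -da distC bd distC ad.
apply/is_G3P; exists a, b, c, d; split; first by rewrite -(perm_uniq ph).
  by move=> x; rewrite -(perm_mem ph).
by move=> i j i6 j6; rewrite -dist_eq1 -(quad_dist q) // dG.
Qed.

(** * Clique pairs, and the family derived from two forced vertices *)

(** The clique pattern without set variables: the four blocks are the fibres of the adjacency pair,
    and the last clause makes them nonempty. *)
Definition clique_pair (u v : T) : Prop :=
  [/\ u != v,
      {in [predC [:: u; v]] &, forall x y, x != y -> e x y} &
      forall bu bv, exists x, [/\ x \notin [:: u; v], e u x = bu & e v x = bv]].

(** The covering hypothesis says that no further vertex is forced. Unless $G_3$ arises, every quad
    is a clique; a vertex outside one enters another by replacement, so it is adjacent to some
    member of the first and, being equidistant from all four, to every member. *)
Lemma family_of_forced (u v : T) :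
  never_removed u -> never_removed v -> u != v -> 2 < #|T| ->
  (forall x, x \notin [:: u; v] ->
     exists s, [/\ uniq s, size s = 4, separable s & x \in s]) ->
  is_G3 e u v \/ clique_pair u v.
Proof.
move=> nu nv uv n3 cover.
have quad_ex x : x \notin [:: u; v] ->
    exists a b c d, x \in [:: a; b; c; d] /\ quad u v a b c d.
  move=> /cover[s [us ss sep xs]].
  have us2 : uniq [:: u, v & s].
    by rewrite /= inE negb_or uv nu // nv.
  have [[a [b [c [d [ps q]]]]] _] := quad_of_separable nu nv us2 ss sep.
  by exists a, b, c, d; rewrite -(perm_mem ps).
have [x0 x0K] : exists x, x \notin [:: u; v].
  apply/existsP; rewrite -negb_forall; apply: contraL n3 => /forallP all2.
  rewrite -leqNgt; apply: leq_trans (card_size [:: u; v]).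
  by apply/subset_leq_card/subsetP => x _.
have [/existsP[x /existsP[y /and4P[xK yK xy nexy]]]|cl] :=
  boolP [exists x, exists y, [&& x \notin [:: u; v], y \notin [:: u; v], x != y & ~~ e x y]].
  have [a [b [c [d [xS q]]]]] := quad_ex x xK.
  have [_ _ _ _ [cl|dG]] := quad_classification nu nv q; last by left; apply: quad_G3 dG.
  have [yS|yS] := boolP (y \in [:: a; b; c; d]); first by rewrite cl in nexy.
  have yS' : y \notin [:: u; v; a; b; c; d].
    by rewrite -[[:: u; v; _; _; _; _]]/([:: u; v] ++ [:: a; b; c; d]) mem_cat negb_or yK.
  have [s [r [ps _ _ [a' [b' [c' [d' [ps' q']]]]]]]] := quad_replace nu nv q yS'.
  have [_ _ _ _ [cl'|dG]] := quad_classification nu nv q'; last by left; apply: quad_G3 dG.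
  have yr t : t \in r -> e y t.
    move=> tr; apply: cl'; rewrite -?(perm_mem ps') ?mem_head ?inE ?tr ?orbT //.
    by apply: contraNneq yS => ->; rewrite (perm_mem ps) inE tr orbT.
  have sr : size r = 3 by have := perm_size ps => -[].
  have t0r : nth u r 0 \in r by rewrite mem_nth ?sr.
  have exy : e x y.
    rewrite e_sym -dist_eq1 (quad_const nu nv q yS' xS (y := nth u r 0)).
      by rewrite dist_eq1 yr.
    by rewrite (perm_mem ps) inE t0r orbT.
  by rewrite exy in nexy.
have [a [b [c [d [xS q]]]]] := quad_ex x0 x0K.
have [ua uc va vb _] := quad_classification nu nv q.
have [us [uab ucd _] [vac vbd _]] := q.
right; split=> //.
  move=> x y xK yK xy; have {}xK : x \notin [:: u; v] := xK; have {}yK : y \notin [:: u; v] := yK.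
  move: cl => /existsPn/(_ x)/existsPn/(_ y).
  by rewrite xK yK xy /= negbK.
have [uS vS] := uniq6 us.
have K i : i < 4 -> nth u [:: a; b; c; d] i \notin [:: u; v].
  move=> i4; have : nth u [:: a; b; c; d] i \in [:: a; b; c; d] by rewrite mem_nth.
  by apply: contraTN; rewrite !in_cons orbF => /orP[] /eqP ->.
case; case.
- by exists a; rewrite -!dist_eq1 ua va; split=> //; apply: (K 0).
- by exists b; rewrite -!dist_eq1 -uab ua vb; split=> //; apply: (K 1).
- by exists c; rewrite -!dist_eq1 uc -vac va; split=> //; apply: (K 2).
by exists d; rewrite -!dist_eq1 -ucd uc -vbd vb; split=> //; apply: (K 3).
Qed.

(** * The converse: a common criterion, and the case of $G_3$ *)

Lemma sub_separable (s s' : seq T) : {subset s' <= s} -> separable s -> separable s'.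
Proof.
move=> ss sep y z /ss ys /ss zs /(sep y z ys zs)[x xs dx]; exists x => //.
by apply: contra xs; apply: ss.
Qed.

(** A separable four-set bounds the dimension above, the size bound on separable lists bounds it
    below, and the covering hypothesis keeps all other vertices from being forced. *)
Lemma metric_dim_forced (u v x0 : T) :
  u != v -> x0 \notin [:: u; v] -> never_removed u -> never_removed v ->
  (forall x, x \notin [:: u; v] ->
     exists s, [/\ uniq s, size s = 4, separable s & x \in s]) ->
  (forall s, uniq s -> separable s -> size s <= 4) ->
  metric_dim e = #|T| - 4 /\ basis_forced e = [set u; v].
Proof.
move=> uv x0K nu nv cover le4.
have [s [us ss sep _]] := cover x0 x0K.
have n4 : 4 <= #|T| by rewrite -ss -(card_uniqP us) max_card.
have dimG : metric_dim e = #|T| - 4.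
  have [R /andP[resR /eqP cR]] := metric_basis_ex.
  have := le4 _ (enum_uniq _) (elimT (resolvingP R) resR).
  have := metric_dim_min (R := [set x | x \notin s]).
  have := cardsC R; have := cardsC [set x | x \notin s].
  have -> : ~: [set x | x \notin s] = [set x in s] by apply/setP=> x; rewrite !inE negbK.
  rewrite [#|[set x in s]|]cardsE (card_uniqP us) ss -cardE -cR => c1 c2 min1 le.
  have {}min1 : #|R| <= #|[set x | x \notin s]|.
    apply: min1; apply/resolvingP; apply: sub_separable sep => x.
    by rewrite mem_enum !inE negbK.
  lia.
split=> //; apply/setP=> x; rewrite in_set2.
apply/(basis_forcedP x dimG n4)/orP => [nx|[]/eqP-> //].
have [_|xu] := eqVneq x u; first by left.
have [_|xv] := eqVneq x v; first by right.
have [|s' [us' ss' sep' xs']] := cover x; first by rewrite !inE negb_or xu.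
by have := nx s' us' ss' sep'; rewrite xs'.
Qed.

(** The diameter is 2: a finite check finds a common neighbour for each nonadjacent pair. *)
Lemma G3_dist (u v : T) : is_G3 e u v ->
  exists a b c d, let h := [:: a; b; c; d; u; v] in
    [/\ uniq h, forall x, x \in h &
        {in iota 0 6 &, forall i j, dist (nth u h i) (nth u h j) = hex_dist G3_distances i j}].
Proof.
case/is_G3P=> a [b [c [d]]]; set h := [:: a; _; _; _; _; _]; case=> uh Th eh.
pose p := nth u h.
have p_inj : {in iota 0 6 &, injective p}.
  move=> i j; rewrite !mem_iota => /andP[_ i6] /andP[_ j6] /eqP.
  by rewrite nth_uniq // => /eqP.
exists a, b, c, d; split=> // i j i6 j6; rewrite -/h -/(p i) -/(p j).
have [<-|ij] := eqVneq i j.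
    rewrite distxx; move: i6; rewrite mem_iota /= add0n; clear.
    by case: i => [|[|[|[|[|[|i]]]]]].
have [/eqP d1|d1] := boolP (hex_dist G3_distances i j == 1).
    by apply/eqP; rewrite d1 dist_eq1 eh // d1.
have [d2 /hasP[k k6 /andP[ik kj]]] : hex_dist G3_distances i j = 2 /\
      has (fun k => (hex_dist G3_distances i k == 1) &&
                    (hex_dist G3_distances k j == 1)) (iota 0 6).
    rewrite !mem_iota /= !add0n in i6 j6; clear - i6 j6 ij d1.
    by case: i i6 ij d1 => [|[|[|[|[|[|i]]]]]] // _; case: j j6 => [|[|[|[|[|[|j]]]]]].
apply/eqP; rewrite d2 eqn_leq (@dist_le (p i) (p j) [:: p k; p j]) /= ?eh ?ik ?kj //.
rewrite ltn_neqAle eq_sym dist_eq1 eh // d1 lt0n dist_eq0 /=.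
by apply: contra_neq ij; apply: p_inj.
Qed.

(** The six points are now the whole graph, so [hex_forced] implies [never_removed]. *)
Lemma G3_quad (u v : T) : is_G3 e u v ->
  exists a b c d, [/\ quad u v a b c d, forall x, x \in [:: u; v; a; b; c; d],
    never_removed u & never_removed v].
Proof.
case/G3_dist=> a [b [c [d]]]; set h := [:: a; _; _; _; _; _]; case=> uh Th.
pose p := nth u h; rewrite -/p => D.
have ph : perm_eq h [:: u; v; a; b; c; d] by apply/permP => ? /=; ring.
have p_inj : {in iota 0 6 &, injective p}.
  move=> i j; rewrite !mem_iota => /andP[_ i6] /andP[_ j6] /eqP.
  by rewrite nth_uniq // => /eqP.
have p_ex x : exists2 i, i \in iota 0 6 & x = p i.
  by have /(nthP u)[i i6 <-] := Th x; exists i; rewrite // mem_iota.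
have never f : f \in iota 0 6 -> hex_forced (hex_dist G3_distances) f -> never_removed (p f).
  move=> f6 hf s us ss sep; apply/negP => fs.
  have us' : perm_eq s (p f :: rem (p f) s) by apply: perm_to_rem.
  have : size (rem (p f) s) = 3 by rewrite size_rem ?ss.
  case: (rem _ _) us' => [|x [|y [|z []]]] // ps _.
  have [i i6 xi] := p_ex x; have [j j6 yj] := p_ex y; have [k k6 zk] := p_ex z.
  move: ps; rewrite xi yj zk => ps; pose t := [:: f; i; j; k].
  have {}ps : perm_eq s (map p t) by [].
  have ut : uniq t by rewrite (perm_uniq ps) in us; apply: map_uniq us.
  move: hf => /allP/(_ i i6)/allP/(_ j j6)/allP/(_ k k6)/implyP/(_ ut).
  have t6 l : l \in t -> l \in iota 0 6.
    by move: f6 i6 j6 k6; rewrite !inE => ? ? ? ? /or4P[] /eqP->.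
  case/hasP=> y' y't /hasP[z' z't /andP[yz' /allP al]].
  have [|||w ws] := sep (p y') (p z'); rewrite ?(perm_mem ps) ?map_f //.
    by apply: contra_neq yz' => /p_inj; apply; apply: t6.
  have [l l6 wl] := p_ex w; rewrite wl !D ?(t6 y') ?(t6 z') // => /eqP[].
  apply/eqP/(implyP (al l l6)); apply: contra ws => lt.
  by rewrite (perm_mem ps) wl map_f.
exists a, b, c, d; split; [|by move=> x; rewrite -(perm_mem ph)|exact: (never 4)|exact: (never 5)].
split; first by rewrite -(perm_uniq ph).
  by split; [apply: etrans (D 4 0 _ _) (esym (D 4 1 _ _))|apply: etrans (D 4 2 _ _) (esym (D 4 3 _ _))|
    rewrite (D 4 0 _ _ : dist u a = _) // (D 4 2 _ _ : dist u c = _)].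
by split; [apply: etrans (D 5 0 _ _) (esym (D 5 2 _ _))|apply: etrans (D 5 1 _ _) (esym (D 5 3 _ _))|
  rewrite (D 5 0 _ _ : dist v a = _) // (D 5 1 _ _ : dist v b = _)].
Qed.

(** Separability passes to sublists, so [f] with three other members would be a forbidden
    four-set. *)
Lemma never_removed_large (f : T) (s : seq T) : never_removed f ->
  uniq s -> separable s -> 4 <= size s -> f \notin s.
Proof.
move=> nf us sep s4; apply/negP => fs.
have ss : {subset f :: take 3 (rem f s) <= s}.
  move=> x; rewrite inE => /predU1P[->//|/mem_take]; exact: mem_rem.
have us4 : uniq (f :: take 3 (rem f s)).
  rewrite /= take_uniq ?rem_uniq // andbT.
  by apply/negP => /mem_take; rewrite mem_rem_uniqF.
have ss4 : size (f :: take 3 (rem f s)) = 4.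
  by rewrite /= size_take size_rem //; case: (size s) s4 => [|[|[|[|[|n]]]]].
by have := nf _ us4 ss4 (sub_separable ss sep); rewrite mem_head.
Qed.

Lemma metric_dim_G3 (u v : T) : is_G3 e u v ->
  metric_dim e = #|T| - 4 /\ basis_forced e = [set u; v].
Proof.
case/G3_quad=> a [b [c [d [q Th nu nv]]]]; have [us _ _] := q.
have [uS vS] := uniq6 us.
have us4 : uniq [:: a; b; c; d] by case/and3P: us.
have inS x : x \notin [:: u; v] -> x \in [:: a; b; c; d].
  have := Th x; rewrite -[[:: u; v; _; _; _; _]]/([:: u; v] ++ [:: a; b; c; d]).
  by rewrite mem_cat => /orP[->|].
apply: (@metric_dim_forced u v a) => //.
- by case/andP: us; rewrite inE negb_or => /andP[].
- rewrite !inE negb_or; apply/andP.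
  by split; [apply: contraNneq uS|apply: contraNneq vS] => <-; rewrite mem_head.
- move=> x /inS xS; exists [:: a; b; c; d]; split=> //; exact: quad_separable q.
move=> s uniqs sep; rewrite leqNgt; apply/negP => s5.
have [nus nvs] : u \notin s /\ v \notin s.
  by split; apply: never_removed_large; rewrite // ltnW.
have /(uniq_leq_size uniqs) : {subset s <= [:: a; b; c; d]}.
  move=> x xs; apply: inS; rewrite !inE negb_or.
  by apply/andP; split; [apply: contraNneq nus|apply: contraNneq nvs] => <-.
by rewrite leqNgt s5.
Qed.

(** * The converse for clique pairs *)

Lemma clique_pairC (u v : T) : clique_pair u v -> clique_pair v u.
Proof.
have ksym x : (x \in [:: u; v]) = (x \in [:: v; u]) by rewrite !inE orbC.
case=> uv cl types; split; first by rewrite eq_sym.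
  by move=> x y; rewrite ![_ \in [predC _]]inE -!ksym; apply: cl.
by move=> bv bu; have [x [xK ux vx]] := types bu bv; exists x; rewrite -ksym.
Qed.

Lemma clique_pair_dist (u v x : T) : clique_pair u v -> x \notin [:: u; v] ->
  dist u x = if e u x then 1 else 2.
Proof.
case=> uv cl types xK; have [ux|ux] := ifPn; first by apply/eqP; rewrite dist_eq1.
have [t [tK ut _]] := types true true.
apply/eqP; rewrite eqn_leq (@dist_le u x [:: t; x]) //=; last first.
  by rewrite ut cl //; apply: contraNneq ux => <-.
rewrite ltn_neqAle eq_sym dist_eq1 ux lt0n dist_eq0.
by apply: contraNneq xK => <-; rewrite mem_head.
Qed.

(** A clique vertex outside [s] is at distance 1 from every clique vertex in [s], so only [u] and
    [v] can resolve the pair. *)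
Lemma clique_pair_separable (u v : T) (s : seq T) : clique_pair u v -> separable s ->
  {in s &, forall y z, y \notin [:: u; v] -> z \notin [:: u; v] -> y != z ->
     (u \notin s) && (e u y != e u z) || (v \notin s) && (e v y != e v z)}.
Proof.
move=> cp sep y z ys zs yK zK yz; have [uv cl _] := cp.
have cp' := clique_pairC cp.
have ksym x : (x \in [:: v; u]) = (x \in [:: u; v]) by rewrite !inE orbC.
have [x xs dx] := sep y z ys zs yz.
have [xu|xu] := eqVneq x u.
  rewrite -xu xs /=; apply/orP; left; apply: contra dx => /eqP euyz.
  by rewrite xu !(clique_pair_dist cp) // -xu euyz.
have [xv|xv] := eqVneq x v.
  rewrite -xv xs /=; apply/orP; right; apply: contra dx => /eqP evyz.
  by rewrite xv !(clique_pair_dist cp') ?ksym // -xv evyz.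
have xK : x \notin [:: u; v] by rewrite !inE negb_or xu.
have d1 t : t \in s -> t \notin [:: u; v] -> dist x t = 1.
  move=> ts tK; apply/eqP; rewrite dist_eq1 cl //.
  by apply: contraNneq xs => ->.
by rewrite !d1 ?eqxx in dx.
Qed.

Lemma clique_pair_never_removed (u v : T) : clique_pair u v -> never_removed u.
Proof.
move=> cp s us ss sep; apply/negP => su; have [uv _ _] := cp.
(* One bit must tell apart the three members other than [u]. If [v] is in [s], nothing resolves two
   clique vertices; otherwise only adjacency to [v] does. *)
pose h x := if v \in s then x == v else e v x.
have rs x : x \in rem u s -> x \in s by apply: mem_rem.
have ru x : x \in rem u s -> x != u by rewrite mem_rem_uniq // inE => /andP[].
have inj : {in rem u s &, injective h}.
  move=> y z yr zr; apply: contra_eq => yz; rewrite /h.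
  have ss' := clique_pair_separable cp sep (rs y yr) (rs z zr).
  have [vs|vs] := ifPn.
    have [yv|yv] := eqVneq y v; first by rewrite -yv [z == y]eq_sym (negPf yz).
    have [//|zv] := eqVneq z v.
    by move: ss'; rewrite su vs !inE !negb_or yv zv !ru // => /(_ isT isT yz).
  have nv x : x \in rem u s -> x != v by move/rs=> xs; apply: contraNneq vs => <-.
  by move: ss'; rewrite su vs !inE !negb_or !ru // !nv // => /(_ isT isT yz).
have : uniq (map h (rem u s)) by rewrite map_inj_in_uniq // rem_uniq.
move/card_uniqP; rewrite size_map size_rem // ss => c3.
by have := max_card [in map h (rem u s)]; rewrite c3 card_bool.
Qed.

(** Clique vertices of distinct adjacency types form a separable set. Any clique vertex completes to
    four types by standing for its own, and a separable set avoiding [u] and [v] repeats no type. *)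
Lemma metric_dim_clique_pair (u v : T) : clique_pair u v ->
  metric_dim e = #|T| - 4 /\ basis_forced e = [set u; v].
Proof.
move=> cp; have [uv cl types] := cp.
have nu := clique_pair_never_removed cp.
have nv := clique_pair_never_removed (clique_pairC cp).
have [a [aK ua va]] := types true true; have [b [bK ub vb]] := types true false.
have [c [cK uc vc]] := types false true; have [d [dK ud vd]] := types false false.
pose t x := (e u x, e v x).
have transversal s : all [predC [:: u; v]] s -> uniq (map t s) -> separable s.
  move=> /allP sK inj; apply: (@separable_map [:: u; v]) => [|y z ys zs [duyz dvyz]].
    rewrite /= andbT; apply/andP; split; apply/negP => /sK.
      by rewrite !inE eqxx.
    by rewrite !inE eqxx orbT.
  by apply: (uniq_map_inj inj) => //; rewrite /t -!dist_eq1 duyz dvyz.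
apply: (@metric_dim_forced u v a) => //.
  move=> x xK; case ux : (e u x); case vx : (e v x).
  - exists [:: x; b; c; d].
    have ut : uniq (map t [:: x; b; c; d]) by rewrite /t /= ux vx ub vb uc vc ud vd.
    by split; rewrite ?mem_head ?(map_uniq ut) //; apply: transversal ut; rewrite /= xK bK cK dK.
  - exists [:: x; a; c; d].
    have ut : uniq (map t [:: x; a; c; d]) by rewrite /t /= ux vx ua va uc vc ud vd.
    by split; rewrite ?mem_head ?(map_uniq ut) //; apply: transversal ut; rewrite /= xK aK cK dK.
  - exists [:: x; a; b; d].
    have ut : uniq (map t [:: x; a; b; d]) by rewrite /t /= ux vx ua va ub vb ud vd.
    by split; rewrite ?mem_head ?(map_uniq ut) //; apply: transversal ut; rewrite /= xK aK bK dK.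
  exists [:: x; a; b; c].
  have ut : uniq (map t [:: x; a; b; c]) by rewrite /t /= ux vx ua va ub vb uc vc.
  by split; rewrite ?mem_head ?(map_uniq ut) //; apply: transversal ut; rewrite /= xK aK bK cK.
move=> s us sep; rewrite leqNgt; apply/negP => s5.
have nus : u \notin s by apply: never_removed_large; rewrite // ltnW.
have nvs : v \notin s by apply: never_removed_large; rewrite // ltnW.
have sK x : x \in s -> x \notin [:: u; v].
  move=> xs; rewrite !inE negb_or.
  by apply/andP; split; [apply: contraNneq nus|apply: contraNneq nvs] => <-.
have inj : {in s &, injective t}.
  move=> y z ys zs; apply: contra_eq => yz; rewrite /t xpair_eqE negb_and.
  by have := clique_pair_separable cp sep ys zs (sK y ys) (sK z zs) yz; rewrite nus nvs.
have : uniq (map t s) by rewrite map_inj_in_uniq.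
move/card_uniqP; rewrite size_map => c5.
by have := max_card [in map t s]; rewrite c5 card_prod !card_bool leqNgt s5.
Qed.

(** * Agreement with the partition form of the clique pattern *)

Lemma is_clique_typeP (u v : T) : is_clique_type e u v <-> clique_pair u v.
Proof.
split.
  move=> [K [V1 [V2 [V3 [V4 []]]]]] [uv uK vK KT] [clK _] [_ partV] [eu neu] [ev nev].
  have inK x : x \notin [:: u; v] -> x \in K.
    have := in_setT x; rewrite -KT inE in_set2 !inE => /orP[-> //|->]; by [].
  have VE A : A \in [set V1; V2; V3; V4] -> exists2 x, x \in A & x \notin [:: u; v].
    move=> AV; have /set0Pn[x xA] : A != set0.
      by apply: contraTneq AV => ->; case/and3P: partV.
    exists x => //; have xK : x \in K.
      by rewrite -(cover_partition partV); apply/bigcupP; exists A.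
    by rewrite !inE negb_or; apply/andP; split; [apply: contraNneq uK|apply: contraNneq vK] => <-.
  split=> //; first by move=> x y /inK xK /inK yK; apply: clK.
  case; case.
  - have [x xV xK] := VE V1 ltac:(by rewrite !inE eqxx).
    by exists x; split=> //; [apply: eu|apply: ev]; rewrite inE xV.
  - have [x xV xK] := VE V2 ltac:(by rewrite !inE eqxx ?orbT).
    by exists x; split=> //; [apply: eu|apply/negbTE/nev]; rewrite inE xV ?orbT.
  - have [x xV xK] := VE V3 ltac:(by rewrite !inE eqxx ?orbT).
    by exists x; split=> //; [apply/negbTE/neu|apply: ev]; rewrite inE xV ?orbT.
  have [x xV xK] := VE V4 ltac:(by rewrite !inE eqxx ?orbT).
  by exists x; split=> //; [apply/negbTE/neu|apply/negbTE/nev]; rewrite inE xV ?orbT.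
case=> uv cl types.
pose V bu bv := [set x | [&& x \notin [:: u; v], e u x == bu & e v x == bv]].
(* Every fibre is inhabited, so distinct boolean pairs give distinct blocks. *)
have V_inj bu bv cu cv : V bu bv = V cu cv -> (bu = cu) * (bv = cv).
  have [x [xK ux vx]] := types bu bv; move/setP/(_ x).
  rewrite !inE in xK *; by rewrite xK ux vx !eqxx /= => /esym/andP[/eqP <- /eqP <-].
have VP A : reflect (exists bu bv, A = V bu bv)
    (A \in [set V true true; V true false; V false true; V false false]).
  rewrite !inE; apply: (iffP idP) => [|[bu [bv ->]]].
    by case/orP=> [/orP[/orP[]|]|] /eqP ->; do 2!eexists.
  by case: bu; case: bv; rewrite eqxx ?orbT.
exists (~: [set u; v]), (V true true), (V true false), (V false true), (V false false).
split.
- by rewrite !inE !eqxx ?orbT uv setUC setUCr.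
- split; last by have := cardsC [set u; v]; rewrite cards2 uv; lia.
  by move=> x y; rewrite !in_setC !in_set2 => xK yK; apply: cl; rewrite !inE.
- split.
    by rewrite /= !inE !negb_or; do !(apply/andP; split) => //; apply/eqP => /V_inj[].
  apply/and3P; split.
  + apply/eqP/setP=> x; rewrite in_setC in_set2; apply/bigcupP/idP => [[A /VP[bu [bv ->]]]|xK].
      by rewrite !inE => /andP[].
    exists (V (e u x) (e v x)); first by apply/VP; exists (e u x), (e v x).
    by rewrite !inE xK !eqxx.
  + apply/trivIsetP=> A B /VP[bu [bv ->]] /VP[cu [cv ->]].
    rewrite -setI_eq0; apply: contra_neqT => /set0Pn[x].
    by rewrite !inE => /andP[/and3P[_ /eqP-> /eqP->] /and3P[_ /eqP-> /eqP->]].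
  apply/VP=> -[bu [bv]] /setP; have [x [xK ux vx]] := types bu bv.
  by move/(_ x); rewrite !inE in xK *; rewrite xK ux vx !eqxx.
- by split=> x; rewrite !inE => /orP[] /and3P[_ /eqP-> _].
by split=> x; rewrite !inE => /orP[] /and3P[_ _ /eqP->].
Qed.

End Distance.

Theorem theorem13 (T : finType) (e : rel T) (e_sym : symmetric e)
    (e_irr : irreflexive e) (e_conn : forall x y : T, connect e x y)
    (n_ge6 : 6 <= #|T|) :
  ((metric_dim e = #|T| - 4 /\ #|basis_forced e| = 2) <-> in_family e) /\
  (forall u v : T, family_with e u v -> basis_forced e = [set u; v]).
Proof.
have family u v : family_with e u v ->
    metric_dim e = #|T| - 4 /\ basis_forced e = [set u; v].
  by case=> [/metric_dim_G3|/is_clique_typeP/metric_dim_clique_pair]; apply.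
split; last by move=> u v /family[].
split=> [[dimG forced2]|[u [v fuv]]]; last first.
  have [dimG forced] := family u v fuv; split=> //; rewrite forced cards2.
  case: fuv => [/(G3_quad e_irr e_conn)[? [? [? [? [[us _ _] _ _ _]]]]]|/is_clique_typeP[-> //]].
  by case/andP: us; rewrite inE negb_or => /andP[->].
have n4 : 4 <= #|T| by apply: leq_trans n_ge6.
have /eqP/cards2P[u [v [uv forced]]] := forced2.
have forcedP f := basis_forcedP e_sym e_conn f dimG n4.
suff : is_G3 e u v \/ clique_pair e u v.
  by exists u, v; rewrite /family_with is_clique_typeP.
apply: family_of_forced => //.
- by apply/forcedP; rewrite forced !inE eqxx.
- by apply/forcedP; rewrite forced !inE eqxx orbT.
- exact: leq_trans n_ge6.
(* A vertex other than [u] and [v] is missed by some metric basis, whose complement is the required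
   separable four-set. *)
move=> x xK; have : x \notin basis_forced e by rewrite forced !inE in xK *.
rewrite inE => /forallPn[R]; rewrite negb_imply => /andP[bR xR].
have [sep sR] := iffLR (metric_basisP e_sym e_conn R dimG n4) bR.
by exists (enum (~: R)); split; rewrite ?enum_uniq // mem_enum inE.
Qed.
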